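(* For every $\rho > 0$ there exist constants $C, C' \in (0,1)$ (depending only on $\rho$) such that the following holds when $d \in \mathbb{N}$ is sufficiently large. Let $n, d, k \in \mathbb{N}$ and $\alpha \in (0,1)$ satisfy $$d \leq 2^{Cn},\qquad k \leq d^{C},\qquad n = C' k \ln(d/2k),\qquad \alpha \leq C\sqrt{\frac{\ln(d/2k)}{n}},$$ and let $\hat{t} : \{\pm1\}^{n\times d} \to \{0,1\}^d$ be any randomized algorithm such that for every $X \in \{\pm1\}^{n\times d}$, $$\Pr\big[\hat{t}(X) \text{ is an } \alpha\text{-approximate top-}k \text{ vector for } X\big] \geq 1-\rho.$$ Let $X = (x_1,\dots,x_n) \in \{\pm1\}^{n\times d}$ (rows $x_i$) and $y \in \{\pm1\}^d$ be independent and uniformly random. Then: (1) (Soundness) $\Pr\big[\mathcal{A}_{\rho,d,k}(y,\hat{t}(X)) = \mathrm{IN}\big] \leq \rho$; and (2) (Completeness) $\Pr\Big[\#\{ i \in [n] : \mathcal{A}_{\rho,d,k}(x_i,\hat{t}(X)) = \mathrm{IN}\} < (1-e^2\rho)n\Big] < 2\rho + 2e^{-k/6}$. Probabilities are over $X$, $y$ and the internal randomness of $\hat{t}$.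
   Context: For $X \in \{\pm1\}^{n\times d}$ with entries $x_{ij}$, the $j$-th marginal is $q_j(X) = \frac{1}{n}\sum_{i=1}^n x_{ij}$, and $q_{(k)}(X)$ denotes the $k$-th largest value among $q_1(X),\dots,q_d(X)$. A vector $t \in \{0,1\}^d$ is an $\alpha$-approximate (equivalently, $\alpha$-accurate) top-$k$ vector for $X$ if it has exactly $k$ coordinates equal to $1$ and $q_j(X) \geq q_{(k)}(X) - \alpha$ for every $j$ with $t_j = 1$. The attacker $\mathcal{A}_{\rho,d,k} : \{\pm1\}^d \times \{0,1\}^d \to \{\mathrm{IN},\mathrm{OUT}\}$ is defined by $\mathcal{A}_{\rho,d,k}(y,t) = \mathrm{IN}$ if $\langle y, t\rangle \geq \tau := \sqrt{2k\ln(1/\rho)}$, and $\mathrm{OUT}$ otherwise. *)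

(* Defs.v *)
From HB Require Import structures.
From mathcomp Require Import all_boot all_order all_algebra.
From mathcomp Require Import reals sequences exp.

Set Implicit Arguments.
Unset Strict Implicit.
Unset Printing Implicit Defensive.

Import Order.TTheory GRing.Theory Num.Theory.
Local Open Scope ring_scope.

(* Finite probability, by probability mass functions. *)

Definition distribution (R : realType) (T : finType) (p : T -> R) : Prop :=
  (forall x, 0 <= p x) /\ \sum_x p x = 1.

Definition Pr (R : realType) (T : finType) (p : T -> R) (E : pred T) : R :=
  \sum_(x | E x) p x.

Definition uniform (R : realType) (T : finType) : T -> R :=
  fun=> #|T|%:R^-1.
Arguments uniform : clear implicits.

(* A randomized algorithm, seen through the law of its output on each input:
   since its outputs range over a finite type, this is all of its internal
   randomness that can be observed. *)
Definition randomized (R : realType) (S T : finType) (M : S -> T -> R) : Prop :=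
  forall x, distribution (M x).

(* Joint law of (x, M(x)) for x drawn from p, the randomness of M being
   independent of x. *)
Definition run (R : realType) (S T : finType) (p : S -> R) (M : S -> T -> R) :
    S * T -> R :=
  fun z => p z.1 * M z.1 z.2.

(* {+1,-1}-valued data is encoded by booleans, true standing for +1 and false
   for -1; in 0/1 vectors true stands for 1. *)
Definition pm1 (R : realType) (b : bool) : R := if b then 1 else -1.

Definition marginal (R : realType) (n d : nat) (X : 'M[bool]_(n, d))
    (j : 'I_d) : R :=
  n%:R^-1 * \sum_(i < n) pm1 R (X i j).

(* The k-th largest marginal, counted with multiplicity; the intended range is
   1 <= k <= d. *)
Definition kth_marginal (R : realType) (n d : nat) (X : 'M[bool]_(n, d))
    (k : nat) : R :=
  nth 0 (sort (fun a b : R => b <= a) [seq marginal R X j | j : 'I_d]) k.-1.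

Definition approx_topk (R : realType) (n d k : nat) (alpha : R)
    (X : 'M[bool]_(n, d)) (t : 'rV[bool]_d) : bool :=
  (#|[set j | t 0 j]| == k) &&
  [forall j, t 0 j ==> (kth_marginal R X k - alpha <= marginal R X j)].

Definition IN : bool := true.
Definition OUT : bool := false.

Definition inner (R : realType) (d : nat) (y t : 'rV[bool]_d) : R :=
  \sum_(j < d) pm1 R (y 0 j) * (t 0 j)%:R.

(* Num.sqrt vanishes on negative reals, so that the threshold is 0 when
   rho > 1. *)
Definition threshold (R : realType) (rho : R) (k : nat) : R :=
  Num.sqrt (2 * k%:R * ln (1 / rho)).

Definition attacker (R : realType) (rho : R) (d k : nat)
    (y t : 'rV[bool]_d) : bool :=
  if threshold rho k <= inner R y t then IN else OUT.

(* m is x rounded down or up to an integer (so m = x when x is an integer).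
   This is how an equation such as n = C' k ln (d / 2k) between an integer and a
   real is to be read: were it exact, a suitable constant C' would make it
   unsatisfiable, as only countably many C' solve it for some n, d, k > 0. *)
Definition rounds_to (R : realType) (x : R) (m : nat) : Prop :=
  `|m%:R - x| < 1.

(* Main.v *)
(* Soundness. If t has k ones, the reflection principle improves Hoeffding's
   bound for <y, t> by a factor 2, up to a factor that is close to 1 for large k;
   on the failure event t is arbitrary, but y is independent of t and
   symmetric, so acceptance has probability at most 1/2. The two cases average
   to at most rho. That k is large is forced by the hypotheses, as d <= 2^(C n)
   and n = C' k ln(d/2k) give k >= 1/(2 C C').

   Completeness. Put L = ln(d/2k) and z = sqrt(2 L/n). By a sharp reverse
   Chernoff bound each marginal exceeds (1 - o(1)) z with probability at least
   2k/d, so typically the k-th largest one does, and the rows x_i satisfy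
   sum_i <x_i, t> >= (1 - o(1)) n k z for every accurate t. A union bound over the
   2^n sets G of rows and the at most d^k vectors t shows that typically
   sum_(i in G) <x_i, t> < (1 - 3 rho/8) n k z whenever #|G| <= (1 - rho) n. As the
   threshold is o(k z) when C' is small, the rejected rows cannot make up for
   the difference, hence more than (1 - rho) n rows are accepted. *)

Require Import Defs.
From HB Require Import structures.
From mathcomp Require unstable.
From mathcomp Require Import topology normedtype.
From mathcomp Require Import all_boot all_order all_algebra.
From mathcomp Require Import reals sequences exp.
From mathcomp Require Import ring lra.

Set Implicit Arguments.
Unset Strict Implicit.
Unset Printing Implicit Defensive.

Import Order.TTheory GRing.Theory Num.Theory.
Import numFieldNormedType.Exports.
Local Open Scope ring_scope.

(** * Exponential bounds *)

(** Coefficient comparison behind [e^x + e^-x <= 2 e^(x^2/2)]: it says that [x^(2m)/(2m)!] is at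
    most [(x^2/2)^m/m!]. *)
Lemma fact_double_ge m : (2 ^ m * m`! <= (m.*2)`!)%N.
Proof.
elim: m => // m IH; rewrite doubleS !factS expnS.
have -> : (2 * 2 ^ m * (m.+1 * m`!) = m.*2.+2 * (2 ^ m * m`!))%N.
  by rewrite mulnACA -doubleS -mul2n.
by rewrite leq_mul // (leq_trans IH) // leq_pmull.
Qed.

Lemma expR_series_le (R : realType) (x : R) n :
  0 <= x -> \sum_(0 <= i < n) x ^+ i / i`!%:R <= expR x.
Proof.
move=> x0; apply: nondecreasing_cvgn_le; last exact: is_cvg_series_exp_coeff.
by apply: nondecreasing_series => i _ _; rewrite divr_ge0 ?exprn_ge0.
Qed.

Lemma expR_sym_series_le (R : realType) (x : R) n :
  \sum_(0 <= i < n) (x ^+ i + (- x) ^+ i) / i`!%:R <= 2 * expR (x ^+ 2 / 2).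
Proof.
have t0 i : 0 <= (x ^+ i + (- x) ^+ i) / i`!%:R.
  rewrite divr_ge0 // exprNn -signr_odd; case: (boolP (odd i)) => oi.
    by rewrite expr1 mulN1r subrr.
  by rewrite expr0 mul1r addr_ge0 // exprn_even_ge0.
(* All terms being nonnegative, the sum may be extended to [n.*2] terms. Then the odd ones vanish
   and the even ones match the series of [e^(x^2/2)] one by one. *)
apply: (@le_trans _ _ (\sum_(0 <= i < n.*2) (x ^+ i + (- x) ^+ i) / i`!%:R)).
  by rewrite (@big_cat_nat _ _ _ n 0 n.*2) //= -?addnn ?leq_addr // lerDl sumr_ge0.
apply: (@le_trans _ _ (2 * \sum_(0 <= i < n) (x ^+ 2 / 2) ^+ i / i`!%:R)); last first.
  by rewrite ler_pM2l // expR_series_le // divr_ge0 // sqr_ge0.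
elim: n => [|n IH]; first by rewrite !big_nil mulr0.
rewrite doubleS !big_nat_recr //= mulrDr -addrA lerD //.
rewrite [(- x) ^+ n.*2.+1]exprNn -signr_odd /= odd_double expr1 mulN1r subrr.
rewrite mul0r addr0 [(- x) ^+ _]exprNn -signr_odd odd_double expr0 mul1r.
rewrite (_ : _ + _ = 2 * x ^+ n.*2); last by ring.
rewrite -mulrA ler_pM2l // -muln2 mulnC exprM expr_div_n.
rewrite -mulrA ler_wpM2l ?(exprn_ge0 n (sqr_ge0 x)) //.
rewrite -invfM lef_pV2 ?posrE ?mulr_gt0 ?exprn_gt0 ?ltr0n ?fact_gt0 //.
by rewrite -natrX -natrM ler_nat mul2n fact_double_ge.
Qed.

Lemma expR_sym_le (R : realType) (x : R) :
  expR x + expR (- x) <= 2 * expR (x ^+ 2 / 2).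
Proof.
have cx (z : R) : cvgn (series (exp_coeff z)) by exact: is_cvg_series_exp_coeff.
rewrite -(@limD R R^o) //.
apply: limr_le.
  exact: is_cvgD.
apply: nearW => n; apply: le_trans (expR_sym_series_le x n).
rewrite [leLHS](_ : _ = series (exp_coeff x) n + series (exp_coeff (- x)) n) //.
by rewrite /series /= -big_split ler_sum // => i _; rewrite mulrDl.
Qed.

Lemma expR_sym_ge (R : realType) (x : R) :
  2 * (1 + x ^+ 2 / 2) <= expR x + expR (- x).
Proof.
wlog x0 : x / 0 <= x.
  move=> H; case: (leP 0 x) => [/H //|xl].
  by have := H (- x); rewrite opprK sqrrN [X in _ -> _ <= X]addrC; apply; lra.
(* e^x + e^-x - 2 = (e^(x/2) - e^(-x/2))^2, and e^(x/2) >= 1 + x/2 + x^2/8 *)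
have y0 : 0 <= x / 2 by lra.
set y := x / 2 in y0; have -> : x = y + y by rewrite /y; field.
rewrite opprD !expRD.
have q0 := expR_gt0 y.
have e2 : expR y * expR (- y) = 1 by exact: expRxMexpNx_1.
have e1 : 1 + y + y ^+ 2 / 2 <= expR y.
  have := expR_series_le 3 y0.
  by rewrite !big_nat_recr //= big_nil !add0r expr0 expr1 !divr1.
suff : 2 * y <= expR y - expR (- y) by move: (expR y) (expR (- y)) e2 => a b; nra.
suff : expR (- y) <= expR y - 2 * y by lra.
rewrite expRN -div1r ler_pdivrMr //.
have y2 := sqr_ge0 y.
have : (1 + y + y ^+ 2 / 2 - 2 * y) * (1 + y + y ^+ 2 / 2) <= (expR y - 2 * y) * expR y.
  by apply: ler_pM => //; lra || nra.
by apply: le_trans; have := sqr_ge0 (y ^+ 2); nra.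
Qed.

(** Apply [1 + u <= e^u] at [u = -(x - x^2)] and use [(1 - x + x^2)(1 + x) = 1 + x^3 >= 1]. *)
Lemma expR_le1D (R : realType) (x : R) : 0 <= x <= 1 -> expR (x - x ^+ 2) <= 1 + x.
Proof.
move=> /andP[x0 x1].
rewrite -[X in expR X]opprK expRN invf_ple ?posrE ?expR_gt0 //; last lra.
apply: (@le_trans _ _ (1 + - (x - x ^+ 2))); last exact: expR_ge1Dx.
rewrite -div1r ler_pdivrMr; last lra.
have : 0 <= x ^+ 3 by exact: exprn_ge0.
nra.
Qed.

(** The exponent falls short of the one in [expR_sym_le] only at fourth order, which is what makes
    the reverse Chernoff bound sharp. *)
Lemma expR_sym_ge_expR (R : realType) (x : R) : x ^+ 2 <= 2 ->
  2 * expR (x ^+ 2 / 2 - x ^+ 4 / 4) <= expR x + expR (- x).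
Proof.
move=> xl; apply: le_trans (expR_sym_ge x); rewrite ler_pM2l //.
have -> : x ^+ 4 / 4 = (x ^+ 2 / 2) ^+ 2 by field.
by apply: expR_le1D; have := sqr_ge0 x; lra.
Qed.

(** * Sums over sign matrices *)

Lemma sum_mx_prod (R : realType) (m n : nat) (F : 'I_m -> 'I_n -> bool -> R) :
  \sum_(X : 'M[bool]_(m, n)) \prod_i \prod_j F i j (X i j)
    = \prod_i \prod_j \sum_b F i j b.
Proof.
rewrite pair_big bigA_distr_bigA /=.
pose h (f : {ffun 'I_m * 'I_n -> bool}) : 'M[bool]_(m, n) := \matrix_(i, j) f (i, j).
rewrite (reindex h) /=; last first.
  exists (fun X : 'M[bool]_(m, n) => [ffun p => X p.1 p.2]) => [f _|X _].
    by apply/ffunP => -[i j]; rewrite ffunE mxE.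
  by apply/matrixP => i j; rewrite mxE ffunE.
apply: eq_bigr => f _; rewrite pair_big /=.
by apply: eq_bigr => -[i j] _; rewrite mxE.
Qed.

Lemma sum_mx_prod_col (R : realType) (m n : nat) (h : 'cV[bool]_m -> R) :
  \sum_(X : 'M[bool]_(m, n)) \prod_j h (col j X) = (\sum_c h c) ^+ n.
Proof.
have -> : (\sum_c h c) ^+ n = \prod_(j < n) \sum_c h c.
  by rewrite prodr_const card_ord.
rewrite bigA_distr_bigA /=.
pose g (f : {ffun 'I_n -> 'cV[bool]_m}) : 'M[bool]_(m, n) := \matrix_(i, j) f j i 0.
rewrite (reindex g) /=; last first.
  exists (fun X : 'M[bool]_(m, n) => [ffun j => col j X]) => [f _|X _].
    apply/ffunP => j; rewrite ffunE; apply/matrixP => i k.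
    by rewrite !mxE ord1.
  by apply/matrixP => i j; rewrite mxE ffunE mxE.
apply: eq_bigr => f _; apply: eq_bigr => j _; congr h.
by apply/matrixP => i k; rewrite !mxE ord1.
Qed.

Lemma sum_expR_signs (R : realType) (m n : nat) (a : 'I_m -> 'I_n -> R) :
  \sum_(X : 'M[bool]_(m, n)) expR (\sum_i \sum_j a i j * pm1 R (X i j))
    = \prod_i \prod_j (expR (a i j) + expR (- a i j)).
Proof.
rewrite (eq_bigr (fun X : 'M[bool]_(m, n) =>
    \prod_i \prod_j expR (a i j * pm1 R (X i j)))); last first.
  by move=> X _; rewrite expR_sum; apply: eq_bigr => i _; rewrite expR_sum.
rewrite (sum_mx_prod (fun i j b => expR (a i j * pm1 R b))).
by apply: eq_bigr => i _; apply: eq_bigr => j _; rewrite big_bool /= mulr1 mulrN1.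
Qed.

Lemma sum_expR_signs_le (R : realType) (m n : nat) (a : 'I_m -> 'I_n -> R) :
  \sum_(X : 'M[bool]_(m, n)) expR (\sum_i \sum_j a i j * pm1 R (X i j))
    <= 2 ^+ (m * n) * expR ((\sum_i \sum_j a i j ^+ 2) / 2).
Proof.
rewrite sum_expR_signs mulr_suml expR_sum mulnC exprM.
have -> : (2 ^+ n) ^+ m = \prod_(i < m) (2 ^+ n) :> R by rewrite prodr_const card_ord.
rewrite -big_split /=; apply: ler_prod => i _; apply/andP; split.
  by rewrite prodr_ge0 // => j _; rewrite addr_ge0 ?expR_ge0.
rewrite mulr_suml expR_sum.
have -> : 2 ^+ n = \prod_(j < n) 2 :> R by rewrite prodr_const card_ord.
rewrite -big_split /=; apply: ler_prod => j _; apply/andP; split.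
  by rewrite addr_ge0 ?expR_ge0.
exact: expR_sym_le.
Qed.

Lemma hoeffding_signs (R : realType) (m n : nat) (a : 'I_m -> 'I_n -> R) (lam u : R) :
  0 <= lam ->
  #|[set X : 'M[bool]_(m, n) | u <= \sum_i \sum_j a i j * pm1 R (X i j)]|%:R
    <= 2 ^+ (m * n) * expR (lam ^+ 2 / 2 * (\sum_i \sum_j a i j ^+ 2) - lam * u).
Proof.
move=> lam0; rewrite expRD mulrA -ler_pdivrMr ?expR_gt0 // -expRN opprK.
apply: (@le_trans _ _ (\sum_(X : 'M[bool]_(m, n))
    expR (\sum_i \sum_j (lam * a i j) * pm1 R (X i j)))); last first.
  apply: le_trans (sum_expR_signs_le _) _; rewrite ler_pM2l ?exprn_gt0 // ler_expR.
  rewrite mulrAC ler_pM2r ?invr_gt0 // mulr_sumr ler_sum // => i _.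
  by rewrite mulr_sumr ler_sum // => j _; rewrite exprMn.
rewrite -sum1_card natr_sum mulr_suml big_mkcond /=.
apply: ler_sum => X _; rewrite inE; case: ifP => [uX|_]; last exact: expR_ge0.
rewrite mul1r ler_expR (le_trans (ler_wpM2l lam0 uX)) // mulr_sumr ler_sum // => i _.
by rewrite mulr_sumr ler_sum // => j _; rewrite mulrA.
Qed.

(** Under the weight [e^(lam S)] the sum [S] concentrates around [n lam]. A vector with [S] within a
    factor [1 +- eps] of it has weight at most [e^(lam s')], so the total weight [M lam] forces many
    such vectors. *)
Lemma reverse_chernoff_signs (R : realType) (n : nat) (lam eps : R) :
  0 < eps <= 1 -> 0 < lam <= eps -> 8 <= n%:R * lam ^+ 2 * eps ^+ 2 ->
  2 ^+ n * expR (- ((1 + eps) ^+ 2 * (n%:R * lam ^+ 2) / 2)) <=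
  #|[set c : 'cV[bool]_n | (1 - eps) * n%:R * lam <= \sum_i pm1 R (c i 0)]|%:R.
Proof.
move=> /andP[e0 e1] /andP[l0 le] a8.
set a := n%:R * lam ^+ 2 in a8 *.
set N := #|_|%:R.
pose S (c : 'cV[bool]_n) : R := \sum_i pm1 R (c i 0).
have SE (t : R) (c : 'cV[bool]_n) :
    \sum_(i < n) \sum_(j < 1) t * pm1 R (c i j) = t * S c.
  by rewrite /S mulr_sumr; apply: eq_bigr => i _; rewrite big_ord1.
pose M t := \sum_(c : 'cV[bool]_n) expR (t * S c).
have Mle t : M t <= 2 ^+ n * expR (n%:R * t ^+ 2 / 2).
  have := sum_expR_signs_le (fun (_ : 'I_n) (_ : 'I_1) => t).
  rewrite /= muln1; under eq_bigr do rewrite SE.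
  move=> /le_trans; apply; rewrite ler_pM2l ?exprn_gt0 // ler_expR ler_pM2r ?invr_gt0 //.
  under eq_bigr do rewrite big_ord1.
  by rewrite sumr_const card_ord mulr_natl.
have Mge : 2 ^+ n * expR (a / 2 - a * lam ^+ 2 / 4) <= M lam.
  have := sum_expR_signs (fun (_ : 'I_n) (_ : 'I_1) => lam).
  rewrite /=.
  under eq_bigr do rewrite SE.
  rewrite -/(M lam) => ->.
  under eq_bigr do rewrite big_ord1.
  have -> : a / 2 - a * lam ^+ 2 / 4 = n%:R * (lam ^+ 2 / 2 - lam ^+ 4 / 4).
    by rewrite /a; field.
  rewrite expRM_natl -exprMn prodr_const card_ord lerXn2r //.
  1,2: by rewrite nnegrE ?addr_ge0 ?mulr_ge0 ?expR_ge0.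
  by apply: expR_sym_ge_expR; nra.
(* Off the window [s, s'] the tilted weight e^(lam S) is dominated by the
   weights with tilts lam - del and lam + del. *)
pose s := (1 - eps) * n%:R * lam; pose s' := (1 + eps) * n%:R * lam.
pose del := eps * lam.
have del0 : 0 < del by rewrite mulr_gt0.
have key : M lam <= expR (lam * s') * N + expR (del * s) * M (lam - del)
                  + expR (- (del * s')) * M (lam + del).
  rewrite /N -sum1_card natr_sum !mulr_sumr big_mkcond -!big_split /=.
  apply: ler_sum => c _; rewrite inE -/(S c) -/s -!expRD.
  have p1 := expR_ge0 (lam * s'); have p2 := expR_ge0 (del * s + (lam - del) * S c).
  have p3 := expR_ge0 (- (del * s') + (lam + del) * S c).
  have [sS|Ss] := leP s (S c).
    have [Ss'|s'S] := leP (S c) s'.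
      suff : expR (lam * S c) <= expR (lam * s') by lra.
      by rewrite ler_expR ler_pM2l.
    suff : expR (lam * S c) <= expR (- (del * s') + (lam + del) * S c) by lra.
    by rewrite ler_expR; nra.
  suff : expR (lam * S c) <= expR (del * s + (lam - del) * S c) by lra.
  by rewrite ler_expR; nra.
have T : expR (del * s) * M (lam - del) <= 2 ^+ n * expR (a / 2 - a * eps ^+ 2 / 2).
  apply: le_trans (ler_wpM2l (expR_ge0 _) (Mle _)) _.
  rewrite mulrCA ler_pM2l ?exprn_gt0 // -expRD ler_expR le_eqVlt; apply/orP; left.
  by apply/eqP; rewrite /del /s /a; field.
have T' : expR (- (del * s')) * M (lam + del) <= 2 ^+ n * expR (a / 2 - a * eps ^+ 2 / 2).
  apply: le_trans (ler_wpM2l (expR_ge0 _) (Mle _)) _.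
  rewrite mulrCA ler_pM2l ?exprn_gt0 // -expRD ler_expR le_eqVlt; apply/orP; left.
  by apply/eqP; rewrite /del /s' /a; field.
(* By [lam <= eps] and [a8] the exponents differ by at least [a eps^2 / 4 >= 2], and
   [3 = 1 + 2 <= e^2]. Each side of the window thus carries at most a third of [M lam], which leaves
   a third for the window. *)
have E3 : 3 * expR (a / 2 - a * eps ^+ 2 / 2) <= expR (a / 2 - a * lam ^+ 2 / 4).
  have -> : a / 2 - a * lam ^+ 2 / 4
    = (a * eps ^+ 2 / 2 - a * lam ^+ 2 / 4) + (a / 2 - a * eps ^+ 2 / 2) by field.
  rewrite [leRHS]expRD ler_pM2r ?expR_gt0 //; apply: le_trans (expR_ge1Dx _).
  have : a * lam ^+ 2 <= a * eps ^+ 2 by rewrite ler_wpM2l ?mulr_ge0 ?sqr_ge0 //; nra.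
  by lra.
have E4 : 2 ^+ n * expR (a / 2 - a * eps ^+ 2 / 2) <= expR (lam * s') * N.
  have : 2 ^+ n * (3 * expR (a / 2 - a * eps ^+ 2 / 2)) <= M lam.
    by apply: le_trans Mge; rewrite ler_pM2l ?exprn_gt0.
  by lra.
rewrite -(ler_pM2l (expR_gt0 (lam * s'))); apply: le_trans E4.
rewrite mulrCA -expRD ler_pM2l ?exprn_gt0 // ler_expR le_eqVlt; apply/orP; left.
by apply/eqP; rewrite /s' /a; field.
Qed.

(** * The reflection principle *)

Definition cons_rV (d : nat) (b : bool) (y : 'rV[bool]_d) : 'rV[bool]_d.+1 :=
  \row_j if unlift ord0 j is Some j' then y 0 j' else b.

Lemma cons_rV0 d b (y : 'rV[bool]_d) : cons_rV b y 0 ord0 = b.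
Proof. by rewrite mxE unlift_none. Qed.

Lemma cons_rVS d b (y : 'rV[bool]_d) j : cons_rV b y 0 (lift ord0 j) = y 0 j.
Proof. by rewrite mxE liftK. Qed.

Lemma cons_rV_eta d (t : 'rV[bool]_d.+1) :
  t = cons_rV (t 0 ord0) (\row_j t 0 (lift ord0 j)).
Proof.
apply/rowP => j; case: (unliftP ord0 j) => [j'|] ->.
  by rewrite cons_rVS mxE.
by rewrite cons_rV0.
Qed.

Lemma sum_rV_recl (R : realType) (d : nat) (G : 'rV[bool]_d.+1 -> R) :
  \sum_y G y = \sum_b \sum_(y : 'rV[bool]_d) G (cons_rV b y).
Proof.
rewrite pair_big /= (reindex (fun p : bool * 'rV[bool]_d => cons_rV p.1 p.2)) //=.
exists (fun t => (t 0 ord0, \row_j t 0 (lift ord0 j))) => [[b y] _|t _] /=.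
  rewrite cons_rV0; congr pair; apply/rowP => j.
  by rewrite mxE cons_rVS.
by rewrite -cons_rV_eta.
Qed.

Lemma inner_cons (R : realType) d b c (y t : 'rV[bool]_d) :
  inner R (cons_rV b y) (cons_rV c t) = pm1 R b * c%:R + inner R y t.
Proof.
rewrite /inner big_ord_recl !cons_rV0; congr (_ + _).
by apply: eq_bigr => j _; rewrite !cons_rVS.
Qed.

Lemma inner_negb (R : realType) d (y t : 'rV[bool]_d) :
  inner R (map_mx negb y) t = - inner R y t.
Proof.
rewrite /inner -sumrN; apply: eq_bigr => j _; rewrite mxE -mulNr.
by case: (y 0 j); rewrite /= ?opprK.
Qed.

(** Negating [y] turns the second indicator into that of [<y, t> < 0], the complement of the first.
    This settles level 0 of the reflection bound. *)
Lemma sum_inner_pos_sym (R : realType) d (t : 'rV[bool]_d) :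
  \sum_y ((0 <= inner R y t)%R%:R + (0 < inner R y t)%R%:R) = 2 ^+ d :> R.
Proof.
rewrite big_split /= [X in _ + X](reindex_inj (h := @map_mx _ _ negb 1 d)) /=; last first.
  by apply: inv_inj => y; apply/matrixP => i j; rewrite !mxE negbK.
rewrite -big_split /= (eq_bigr (fun _ => 1)) => [|y _].
  by rewrite sumr_const card_mx card_bool mul1n natrX.
by rewrite inner_negb oppr_gt0 leNgt; case: (_ < 0); rewrite ?add0r ?addr0.
Qed.

(* The summand is twice the indicator of [s <= <y, t>], up to the atom at [s].
   By the reflection principle its average is the probability that the partial
   sums of [<y, t>] ever reach [s], which obeys the same exponential bound as
   the tail itself. The proof is by first-step analysis. *)
Lemma reflection_bound (R : realType) (lam : R) d (t : 'rV[bool]_d) (s : nat) :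
  0 <= lam ->
  \sum_y ((s%:R <= inner R y t)%R%:R + (s%:R < inner R y t)%R%:R)
    <= expR (- (lam * s%:R)) *
       \prod_j (expR (lam * (t 0 j)%:R) + expR (- (lam * (t 0 j)%:R))) :> R.
Proof.
move=> lam0; elim: d t s => [|d IH] t [|s].
(* At level 0 the left side is exactly [2^d], and each factor on the right is at least 2. *)
1,3: rewrite sum_inner_pos_sym mulr0 oppr0 expR0 mul1r.
1,2: rewrite -[X in 2 ^+ X](card_ord) -prodr_const ler_prod // => j _; rewrite ler0n /=.
1,2: by apply: le_trans (expR_sym_ge _); have := sqr_ge0 (lam * (t 0 j)%:R); lra.
  rewrite big1 ?mulr_ge0 ?expR_ge0 ?big_ord0 // => y _.
  by rewrite /inner big_ord0 !ltNge !ler0n lern0 addr0.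
rewrite [t]cons_rV_eta; set c := t 0 ord0; set t' := \row__ _.
rewrite sum_rV_recl big_bool /= big_ord_recl cons_rV0.
under [X in _ <= _ * (_ * X)]eq_bigr do rewrite cons_rVS.
under eq_bigr do rewrite inner_cons.
under [X in _ + X <= _]eq_bigr do rewrite inner_cons.
rewrite /=; set P := \prod_(j < d) _.
(* A zero coordinate of [t] leaves the walk in place. A one moves it by a unit, so level [s.+1]
   splits into [s] and [s.+2], exactly as the factor [e^lam + e^-lam] splits on the right. *)
case: c; last first.
  rewrite mulr0; under eq_bigr do rewrite add0r.
  under [X in _ + X <= _]eq_bigr do rewrite mulr0 add0r.
  by have := IH t' s.+1; rewrite -/P mulr0 oppr0 expR0; lra.
rewrite !mulr1.
have E1 y : (s.+1%:R <= 1 + inner R y t') = (s%:R <= inner R y t').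
  by rewrite -natr1 addrC lerD2l.
have E2 y : (s.+1%:R < 1 + inner R y t') = (s%:R < inner R y t').
  by rewrite -natr1 addrC ltrD2l.
have E3 y : (s.+1%:R <= -1 + inner R y t') = (s.+2%:R <= inner R y t').
  by rewrite -[s.+2%:R]natr1 addrC lerBrDr.
have E4 y : (s.+1%:R < -1 + inner R y t') = (s.+2%:R < inner R y t').
  by rewrite -[s.+2%:R]natr1 addrC ltrBrDr.
under eq_bigr do rewrite E1 E2.
under [X in _ + X <= _]eq_bigr do rewrite E3 E4.
rewrite mulrA mulrDr mulrDl.
rewrite -!expRD.
have -> : - (lam * s.+1%:R) + lam = - (lam * s%:R) by rewrite -natr1; ring.
have -> : - (lam * s.+1%:R) - lam = - (lam * s.+2%:R) by rewrite -[s.+2%:R]natr1; ring.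
by apply: lerD; exact: IH.
Qed.

Lemma inner_tail (R : realType) (lam tau : R) d (t : 'rV[bool]_d) :
  0 <= lam -> 0 < tau ->
  #|[set y | tau <= inner R y t]|%:R
    <= 2 ^+ d * (expR (lam ^+ 2 / 2 * #|[set j | t 0 j]|%:R - lam * (tau - 1)) / 2).
Proof.
move=> lam0 tau0.
(* [s] is the largest integer strictly below [tau]. By strictness both indicators of
   [reflection_bound] equal 1 once [tau <= <y, t>], whence the factor 1/2; rounding turns [tau] into
   [tau - 1]. *)
have [s [st ts]] : exists s : nat, s%:R < tau /\ tau - 1 <= s%:R.
  have /andP[a b] := truncn_itv (ltW tau0).
  have [e|ne] := eqVneq ((Num.truncn tau)%:R) tau.
    exists (Num.truncn tau).-1.
    have : (Num.truncn tau) != 0%N by apply: contra_eq_neq e => ->; rewrite lt_eqF.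
    rewrite -lt0n => /prednK E.
    have : (Num.truncn tau).-1%:R + 1 = tau by rewrite natr1 E.
    by split; lra.
  exists (Num.truncn tau); split; first by rewrite lt_neqAle ne.
  by rewrite -natr1 in b; lra.
have := reflection_bound t s lam0.
rewrite mulrA ler_pdivlMr //.
set L := (X in X <= _ -> _); set Q := (X in _ <= X -> _) => LQ.
have LL : #|[set y | tau <= inner R y t]|%:R * 2 <= L.
  rewrite /L -sum1_card natr_sum mulr_suml big_mkcond /=.
  apply: ler_sum => y _; rewrite inE; case: ifP => [ty|_]; last by rewrite addr_ge0.
  by rewrite (lt_le_trans st ty) (ltW (lt_le_trans st ty)) mul1r.
apply: le_trans LL (le_trans LQ _); rewrite /Q.
apply: (@le_trans _ _ (expR (- (lam * s%:R)) *
    (2 ^+ d * expR (lam ^+ 2 / 2 * #|[set j | t 0 j]|%:R)))).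
  rewrite ler_pM2l ?expR_gt0 //.
  have -> : 2 ^+ d = \prod_(j < d) 2 :> R by rewrite prodr_const card_ord.
  rewrite -sum1_card natr_sum mulr_sumr expR_sum [X in _ * X]big_mkcond -big_split /=.
  apply: ler_prod => j _; rewrite addr_ge0 ?expR_ge0 //=.
  rewrite inE; apply: le_trans (expR_sym_le _) _.
  case: (t 0 j); rewrite !mulr1 ?mulr0.
    by rewrite ler_pM2l // ler_expR; lra.
  by rewrite expr0n /= mul0r expR0 mulr1.
rewrite mulrCA ler_pM2l ?exprn_gt0 // -expRD ler_expR.
have := ler_wpM2l lam0 ts; lra.
Qed.

(** * Tail events of a random sign matrix *)

Lemma threshold_gt0 (R : realType) (rho : R) k :
  0 < rho < 1 -> (0 < k)%N -> 0 < threshold rho k.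
Proof.
move=> /andP[r0 r1] k0; rewrite sqrtr_gt0 !mulr_gt0 ?ltr0n // ln_gt0 //.
by rewrite div1r invf_gt1.
Qed.

Lemma inner_tail_half (R : realType) (tau : R) d (t : 'rV[bool]_d) :
  0 < tau -> #|[set y | tau <= inner R y t]|%:R <= 2 ^+ d * (1 / 2) :> R.
Proof.
move=> tau0; have := inner_tail t (lexx 0) tau0.
by rewrite expr0n /= !mul0r subr0 expR0.
Qed.

(** The tilt [tau / k] gives the exponent [- tau^2/(2k) + tau/k = - ln (1/rho) + tau/k]. The first
    term yields [rho]. The bound on [k] makes [tau/k <= rho], and [e^rho <= 1/(1 - rho)]. *)
Lemma inner_tail_threshold (R : realType) (rho : R) d (t : 'rV[bool]_d) k :
  0 < rho < 1 -> 0 < k%:R :> R -> 2 * ln (1 / rho) <= rho ^+ 2 * k%:R ->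
  #|[set j | t 0 j]| = k ->
  #|[set y | threshold rho k <= inner R y t]|%:R <= 2 ^+ d * (rho / (1 - rho) / 2).
Proof.
move=> /andP[r0 r1] k0 hk tk.
set tau := threshold rho k; set l := ln (1 / rho) in hk.
have tau0 : 0 < tau by apply: threshold_gt0; rewrite ?r0 ?r1 // -(ltr0n R).
have tau2 : tau ^+ 2 = 2 * k%:R * l.
  rewrite sqr_sqrtr // !mulr_ge0 ?ln_ge0 // div1r invf_ge1 //; exact: ltW.
have el : expR (- l) = rho by rewrite /l div1r lnV ?posrE // opprK lnK // posrE.
have tk0 : 0 <= tau / k%:R by rewrite divr_ge0 // ltW.
have tkr : tau / k%:R <= rho.
  rewrite ler_pdivrMr // -ler_sqr ?nnegrE ?mulr_ge0 //; try exact: ltW.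
  by rewrite tau2 exprMn [k%:R ^+ 2]expr2; have := ler_wpM2l (ltW k0) hk; lra.
apply: le_trans (inner_tail t tk0 tau0) _.
rewrite ler_pM2l ?exprn_gt0 // ler_pM2r ?invr_gt0 // tk.
have -> : (tau / k%:R) ^+ 2 / 2 * k%:R - tau / k%:R * (tau - 1) = - l + tau / k%:R.
  have kn : k%:R != 0 :> R by exact: lt0r_neq0.
  have -> : (tau / k%:R) ^+ 2 / 2 * k%:R - tau / k%:R * (tau - 1)
    = - (tau ^+ 2 / (2 * k%:R)) + tau / k%:R by field.
  by rewrite tau2; congr (- _ + _); field.
rewrite expRD el ler_pM2l // -[leLHS]invrK -expRN lef_pV2 ?posrE ?expR_gt0 //; last lra.
by apply: le_trans (expR_ge1Dx _); lra.
Qed.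

Lemma nth_sort_ge (R : realDomainType) (s : seq R) (v : R) k :
  (k < count (fun x => v <= x)%R s)%N -> v <= nth 0 (sort (fun a b => b <= a) s) k.
Proof.
set ge := fun a b : R => b <= a => hk; rewrite leNgt; apply/negP => lt_v.
have sz : size (sort ge s) = size s by rewrite size_sort.
have srt : sorted ge (sort ge s) by apply: sort_sorted => a b; exact: le_total.
have getr : transitive ge by move=> a b c; rewrite /ge => ab ca; exact: le_trans ca ab.
move: hk; rewrite -(permP (permEl (perm_sort ge s))) -[sort ge s](cat_take_drop k).
rewrite count_cat => hk.
have : count (fun x => v <= x)%R (drop k (sort ge s)) = 0%N.
  apply/eqP; rewrite -leqn0 leqNgt -has_count; apply/negP => /hasP[x /(nthP 0)[i]].
  rewrite size_drop nth_drop => ik <-; apply/negP; rewrite -ltNge; apply: le_lt_trans lt_v.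
  apply: (sorted_leq_nth getr _ 0 srt) => //; rewrite ?inE ?leq_addr //.
  - by move=> a; exact: lexx.
  - by rewrite (leq_ltn_trans (leq_addr i k)) // -ltn_subRL.
  - by rewrite -ltn_subRL.
move=> e; rewrite e addn0 in hk.
have := leq_trans hk (count_size _ _).
by rewrite size_take ltnNge; case: ltnP => //; rewrite ?leqnn // => /leq_trans ->.
Qed.

Lemma kth_marginal_ge (R : realType) n d (X : 'M[bool]_(n, d)) k (v : R) :
  (0 < k)%N -> (k <= #|[set j | (v <= marginal R X j)%R]|)%N -> v <= kth_marginal R X k.
Proof.
move=> k0 hk; apply: nth_sort_ge; rewrite prednK // (leq_trans hk) //.
rewrite count_map -sum1_count big_enum_cond -sum1_card.
by apply/eq_leq/eq_bigl => j; rewrite !inE.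
Qed.

(** Lower-tail Chernoff bound for independent columns, with weight 1/2 for each large marginal. A
    column has mean weight at most [1 - k/d <= e^(-k/d)], and having fewer than [k] large marginals
    costs at most [2^k], so the bound is [2^k e^(-k)]. *)
Lemma few_large_marginals (R : realType) n d k (v : R) :
  (0 < d)%N ->
  2 ^+ n * (2 * k%:R / d%:R) <=
    #|[set c : 'cV[bool]_n | v <= n%:R^-1 * \sum_i pm1 R (c i 0)]|%:R :> R ->
  #|[set X : 'M[bool]_(n, d) | (#|[set j | (v <= marginal R X j)%R]| < k)%N]|%:R
    <= 2 ^+ (n * d) * expR (- (k%:R / 6)) :> R.
Proof.
move=> d0; set A := [set c | _] => hA.
pose h (c : 'cV[bool]_n) : R := if c \in A then 1 / 2 else 1.
have h0 c : 0 <= h c by rewrite /h; case: ifP => _; lra.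
have hE (X : 'M[bool]_(n, d)) :
    \prod_j h (col j X) = (1 / 2) ^+ #|[set j | (v <= marginal R X j)%R]|.
  rewrite -prodr_const [RHS]big_mkcond /=; apply: eq_bigr => j _.
  rewrite /h !inE /marginal; congr (if _ <= _ * _ then _ else _).
  by apply: eq_bigr => i _; rewrite mxE.
apply: (@le_trans _ _ (2 ^+ k * \sum_(X : 'M[bool]_(n, d)) \prod_j h (col j X))).
  rewrite -sum1_card natr_sum mulr_sumr big_mkcond /=; apply: ler_sum => X _.
  rewrite inE; case: ifP => [lt_k|_]; last by rewrite mulr_ge0 ?exprn_ge0 ?prodr_ge0.
  rewrite hE -(subnK (ltnW lt_k)) exprD -mulrA -exprMn.
  rewrite (_ : 2 * (1 / 2) = 1) ?expr1n ?mulr1; last by field.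
  by rewrite exprn_ege1 // ler1n.
rewrite sum_mx_prod_col.
have d0' : 0 < d%:R :> R by rewrite ltr0n.
have hs : \sum_c h c <= 2 ^+ n * expR (- (k%:R / d%:R)).
  have -> : \sum_c h c = 2 ^+ n - #|A|%:R / 2.
    rewrite -sum1_card natr_sum mulr_suml [X in _ - X]big_mkcond /=.
    have -> : 2 ^+ n = \sum_(c : 'cV[bool]_n) 1 :> R.
      by rewrite sumr_const card_mx card_bool muln1 natrX.
    rewrite -sumrB; apply: eq_bigr => c _; rewrite /h; case: ifP => _; lra.
  apply: (@le_trans _ _ (2 ^+ n * (1 - k%:R / d%:R))); last first.
    by rewrite ler_pM2l ?exprn_gt0 // expR_ge1Dx.
  by move: hA; move: (2 ^+ n) (d%:R^-1) => x y; lra.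
apply: (@le_trans _ _ (2 ^+ k * (2 ^+ n * expR (- (k%:R / d%:R))) ^+ d)).
  by rewrite ler_pM2l ?exprn_gt0 // lerXn2r // nnegrE ?sumr_ge0 //
    mulr_ge0 ?exprn_ge0 ?expR_ge0.
rewrite exprMn -exprM mulrCA ler_pM2l ?exprn_gt0 //.
rewrite -expRM_natl mulrN mulrCA divff ?lt0r_neq0 // mulr1.
(* This turns [2^k e^(-k)] into [e^(-k/6)]. *)
have e2 : 2 <= expR (5 / 6) :> R.
  have := expR_series_le 3 (_ : 0 <= 5 / 6 :> R).
  rewrite !big_nat_recr //= big_nil !add0r expr0 expr1 !divr1 => H.
  by have := H ltac:(lra); rewrite expr2 (_ : (2`!)%:R = 2) //; lra.
apply: (@le_trans _ _ (expR (5 / 6) ^+ k * expR (- k%:R))).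
  by rewrite ler_pM2r ?expR_gt0 // lerXn2r // nnegrE ?expR_ge0.
by rewrite -expRM_natl -expRD ler_expR le_eqVlt; apply/orP; left; apply/eqP; field.
Qed.

Lemma card_weight_le d k :
  (#|[set t : 'rV[bool]_d | #|[set j | t 0%R j]| == k]| <= d ^ k)%N.
Proof.
pose f (t : 'rV[bool]_d) := [set j | t 0 j].
have fi : injective f.
  by move=> t t' /setP e; apply/rowP => j; have := e j; rewrite !inE.
rewrite -(card_imset _ fi).
apply: (@leq_trans #|[set A : {set 'I_d} | #|A| == k]|).
  apply: subset_leq_card; apply/subsetP => A /imsetP[t].
  by rewrite !inE => tk ->.
rewrite card_draws card_ord.
apply: (@leq_trans (d ^_ k)); first by rewrite -bin_ffact leq_pmulr // fact_gt0.
elim: k d {f fi} => [|k IH] d; first by rewrite ffactn0.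
rewrite ffactnS expnS leq_mul // (leq_trans (IH _)) //.
by case: k {IH} => // k; rewrite leq_exp2r // leq_pred.
Qed.

(** Union bound over at most [2^n d^k] pairs [(G, t)]. For each pair the block sum is a sum of
    [#|G| k] independent signs, to which [hoeffding_signs] applies. *)
Lemma large_block_sums (R : realType) n d k (g lam u : R) :
  0 <= lam -> 0 <= g ->
  #|[set X : 'M[bool]_(n, d) |
      [exists G : {set 'I_n}, exists t : 'rV[bool]_d,
        [&& #|G|%:R <= g, #|[set j | t 0 j]| == k &
            u <= \sum_(i in G) inner R (row i X) t]]]|%:R
    <= 2 ^+ (n * d) * (2 ^+ n * d%:R ^+ k * expR (lam ^+ 2 / 2 * (g * k%:R) - lam * u)).
Proof.
move=> lam0 g0.
pose B (G : {set 'I_n}) (t : 'rV[bool]_d) : {set 'M[bool]_(n, d)} :=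
  [set X | u <= \sum_(i in G) inner R (row i X) t].
pose W := [set t : 'rV[bool]_d | #|[set j | t 0 j]| == k].
have HB (G : {set 'I_n}) t : #|G|%:R <= g -> t \in W ->
    #|B G t|%:R <= 2 ^+ (n * d) * expR (lam ^+ 2 / 2 * (g * k%:R) - lam * u).
  move=> Gg; rewrite inE => /eqP tk.
  pose a i j : R := (i \in G)%:R * (t 0 j)%:R.
  have := hoeffding_signs a u lam0.
  have -> : [set X | u <= \sum_i \sum_j a i j * pm1 R ((X : 'M[bool]_(n, d)) i j)] = B G t.
    apply/setP => X; rewrite !inE; congr (_ <= _).
    rewrite [RHS]big_mkcond /=; apply: eq_bigr => i _; rewrite /a.
    case: (i \in G); last by rewrite big1 // => j _; rewrite !mul0r.
    by rewrite /inner; apply: eq_bigr => j _; rewrite mul1r mxE mulrC.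
  move=> /le_trans; apply; rewrite ler_pM2l ?exprn_gt0 // ler_expR lerD2r.
  apply: ler_wpM2l; first by rewrite divr_ge0 ?sqr_ge0.
  have -> : \sum_i \sum_j a i j ^+ 2 = #|G|%:R * k%:R.
    rewrite -tk -!sum1_card !natr_sum mulr_suml [RHS]big_mkcond /=.
    apply: eq_bigr => i _; rewrite /a; case: (i \in G); last first.
      by rewrite big1 // => j _; rewrite mul0r expr0n.
    rewrite mul1r [RHS]big_mkcond /=; apply: eq_bigr => j _; rewrite mul1r inE.
    by case: (t 0 j); rewrite ?expr1n ?expr0n.
  by rewrite ler_wpM2r.
apply: (@le_trans _ _ (\sum_(G : {set 'I_n}) \sum_(t in W)
    2 ^+ (n * d) * expR (lam ^+ 2 / 2 * (g * k%:R) - lam * u))); last first.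
  rewrite !sumr_const -!mulrnA -[leLHS]mulr_natl mulrCA.
  rewrite ler_pM2l ?exprn_gt0 // ler_pM2r ?expR_gt0 //.
  rewrite natrM mulrC ler_pM // -?natrX ?ler_nat ?card_weight_le //.
  by rewrite -cardsT -powersetT card_powerset cardsT card_ord.
apply: (@le_trans _ _ (\sum_(G : {set 'I_n} | #|G|%:R <= g) \sum_(t in W) #|B G t|%:R)).
  rewrite pair_big_dep /= -natr_sum ler_nat.
  apply: leq_trans (unstable.card_big_setU _ _ _); apply: subset_leq_card.
  apply/subsetP => X; rewrite inE => /existsP[G /existsP[t /and3P[Gg tk uX]]].
  by apply/bigcupP; exists (G, t); rewrite /= ?inE ?Gg.
rewrite [leLHS]big_mkcond /=; apply: ler_sum => G _; case: ifP => Gg.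
  by apply: ler_sum => t tW; exact: HB.
by rewrite sumr_ge0 // => t _; rewrite mulr_ge0 ?exprn_ge0 ?expR_ge0.
Qed.

Lemma sum_inner_rows (R : realType) n d (X : 'M[bool]_(n, d)) (t : 'rV[bool]_d) :
  \sum_i inner R (row i X) t = n%:R * \sum_(j | t 0 j) marginal R X j.
Proof.
rewrite /inner exchange_big /= [in RHS]big_mkcond mulr_sumr; apply: eq_bigr => j _.
case: (t 0 j); last by rewrite big1 ?mulr0 // => i _; rewrite mulr0.
case: n X => [|n] X; first by rewrite big_ord0 mul0r.
rewrite /marginal mulrA divff ?pnatr_eq0 // mul1r.
by apply: eq_bigr => i _; rewrite mulr1 mxE.
Qed.

Lemma sum_inner_topk_ge (R : realType) n d k (alpha v : R) (X : 'M[bool]_(n, d)) t :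
  approx_topk k alpha X t -> v <= kth_marginal R X k ->
  n%:R * (k%:R * (v - alpha)) <= \sum_i inner R (row i X) t.
Proof.
move=> /andP[/eqP tk /forallP topt] vk; rewrite sum_inner_rows ler_wpM2l //.
rewrite -tk -sum1_card natr_sum mulr_suml big_mkcond [leRHS]big_mkcond /=.
apply: ler_sum => j _; rewrite inE; have := topt j; case: (t 0 j) => //= tj.
by rewrite mul1r (le_trans _ tj) // lerD2r.
Qed.

Lemma many_large_marginals (R : realType) (eps L : R) n d k :
  (0 < n)%N -> (0 < k)%N -> (0 < d)%N -> 0 < eps <= 1 ->
  2 * (L / n%:R) <= eps ^+ 2 -> 16 <= eps ^+ 2 * L ->
  L = ln (d%:R / (2 * k%:R)) ->
  #|[set X : 'M[bool]_(n, d) |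
     (#|[set j | ((1 - eps) / (1 + eps) * Num.sqrt (2 * (L / n%:R))
                    <= marginal R X j)%R]| < k)%N]|%:R
    <= 2 ^+ (n * d) * expR (- (k%:R / 6)) :> R.
Proof.
move=> n0 k0 d0 /andP[e0 e1] Ln Le LE.
have n0' : 0 < n%:R :> R by rewrite ltr0n.
have k0' : 0 < k%:R :> R by rewrite ltr0n.
have d0' : 0 < d%:R :> R by rewrite ltr0n.
have ee0 : 0 < eps ^+ 2 by rewrite exprn_gt0.
have L0 : 0 < L by rewrite -(pmulr_rgt0 _ ee0); lra.
set z := Num.sqrt _.
have z2 : z ^+ 2 = 2 * (L / n%:R) by rewrite sqr_sqrtr // mulr_ge0 ?divr_ge0 ?ltW.
have z0 : 0 < z by rewrite sqrtr_gt0 mulr_gt0 // divr_gt0.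
(* Chosen so that the exponent [(1 + eps)^2 n lam^2 / 2] of the reverse Chernoff bound is exactly
   [L]; then [e^(-L) = 2k/d] is the column probability that [few_large_marginals] asks for. *)
pose lam := z / (1 + eps).
have lam0 : 0 < lam by rewrite divr_gt0 //; lra.
have lam_le : lam <= eps.
  have : z <= eps by rewrite -ler_sqr ?nnegrE ?z2 // ltW.
  by rewrite ler_pdivrMr; [nra|lra].
have nlam : (1 + eps) ^+ 2 * (n%:R * lam ^+ 2) / 2 = L.
  rewrite /lam expr_div_n z2; field.
  by rewrite !lt0r_neq0 //; lra.
apply: few_large_marginals => //.
have := @reverse_chernoff_signs R n lam eps.
rewrite nlam e0 e1 lam0 lam_le => H.
have {H} := H isT isT.
have -> : expR (- L) = 2 * k%:R / d%:R.
  by rewrite expRN LE lnK ?posrE ?divr_gt0 ?mulr_gt0 // invf_div.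
have -> : [set c : 'cV[bool]_n | (1 - eps) * n%:R * lam <= \sum_i pm1 R (c i 0)]
   = [set c : 'cV[bool]_n | (1 - eps) / (1 + eps) * z <= n%:R^-1 * \sum_i pm1 R (c i 0)].
  apply/setP => c; rewrite !inE ler_pdivlMl //; congr (_ <= _).
  by rewrite /lam; field; rewrite lt0r_neq0 //; lra.
apply.
(* It remains to check [8 <= n lam^2 eps^2]. As [(1 + eps)^2 <= 4], [n lam^2 >= L/2], and
   [eps^2 L >= 16]. *)
have : (1 + eps) ^+ 2 <= 4 by rewrite (_ : 4 = 2 ^+ 2) ?lerXn2r ?nnegrE //; [lra|lra|ring].
set q := n%:R * _ in nlam *; move: nlam => nlam q4.
have q0 : 0 < q by rewrite mulr_gt0 ?exprn_gt0.
have L2 : L * 2 <= 4 * q.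
  have : (1 + eps) ^+ 2 * q <= 4 * q by rewrite ler_wpM2r // ltW.
  by lra.
have : eps ^+ 2 * (L * 2) <= eps ^+ 2 * (4 * q) by rewrite ler_pM2l.
by lra.
Qed.

(** * The parameter regime *)

(** Here [d <= 2^(C n)] gives [ln d <= C n]. Combined with [n <= 2 C' k L] and [L <= ln d], this
    bounds [k] from below. As [k <= d^C], [ln k <= C ln d], so [L] and [ln d] nearly agree. *)
Lemma parameter_regime (R : realType) (rho C C' : R) n d k :
  0 < rho < 1 / 2 -> C = rho ^+ 2 / (64 * 128) -> C' = rho ^+ 3 / 128 ->
  expR ((256 * 128) / rho ^+ 2) <= d%:R -> d%:R <= 2 `^ (C * n%:R) ->
  k%:R <= d%:R `^ C -> rounds_to (C' * k%:R * ln (d%:R / (2 * k%:R))) n ->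
  let L := ln (d%:R / (2 * k%:R)) in
  [/\ (0 < n)%N, (0 < k)%N, 1 <= 2 * C * C' * k%:R & 128 * 128 <= rho ^+ 2 * L]
  /\ [/\ n%:R <= 2 * C' * k%:R * L, C' * k%:R * L <= 2 * n%:R
       & ln d%:R <= L * (1 + rho / 16)].
Proof.
move=> /andP[r0 r2] CE C'E dbig dn kd nk L.
have C0 : 0 < C by rewrite CE divr_gt0 ?exprn_gt0 ?mulr_gt0.
have C'0 : 0 < C' by rewrite C'E divr_gt0 ?exprn_gt0 ?mulr_gt0.
have rr0 : 0 < rho ^+ 2 by rewrite exprn_gt0.
have rr : rho ^+ 2 < rho / 2 by rewrite expr2; nra.
have Cr : 128 * C <= rho / 2 by rewrite CE; lra.
have d0 : 0 < d%:R :> R by apply: lt_le_trans dbig; exact: expR_gt0.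
set l := ln d%:R.
have lbig : 256 * 128 <= rho ^+ 2 * l.
  rewrite [leRHS]mulrC -ler_pdivrMr // -ler_expR /l lnK ?posrE //.
have l0 : 0 < l.
  by rewrite -(pmulr_rgt0 _ rr0); lra.
have lr : 128 <= rho * l.
  by have : rho ^+ 2 * l <= rho / 2 * l; [rewrite ler_pM2r // ltW | lra].
have l256 : 256 <= l.
  have : rho * l <= 1 / 2 * l by rewrite ler_pM2r // ltW.
  by lra.
have ln2_le1 : ln 2 <= 1 :> R by apply: (@le_ln1Dx R 1); lra.
have ln2_ge0 : 0 <= ln 2 :> R by apply: ln_ge0; lra.
have lCN : l <= C * n%:R.
  have CN0 : 0 <= C * n%:R by rewrite mulr_ge0 // ltW.
  have : ln d%:R <= ln (2 `^ (C * n%:R)) by rewrite ler_ln ?posrE ?powR_gt0.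
  rewrite ln_powR -/l => /le_trans; apply.
  by rewrite ler_piMr.
have n2 : 2 <= n%:R :> R.
  have : C * n%:R <= 1 * n%:R by rewrite ler_wpM2r //; lra.
  by lra.
have k0 : (0 < k)%N.
  rewrite lt0n; apply: contraTneq nk => ->.
  by rewrite /rounds_to mulr0 mul0r subr0 ger0_norm // -leNgt; lra.
have k1 : 1 <= k%:R :> R by rewrite ler1n.
have LE : L = l - (ln 2 + ln k%:R).
  by rewrite /L ln_div ?lnM ?posrE ?mulr_gt0 //; lra.
have lnk0 : 0 <= ln k%:R :> R by exact: ln_ge0 k1.
have lnk : ln k%:R <= C * l :> R.
  have : ln k%:R <= ln (d%:R `^ C) by rewrite ler_ln ?posrE ?powR_gt0 //; lra.
  by rewrite ln_powR.
have Crl : 256 * (C * l) <= rho * l.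
  by rewrite mulrA ler_pM2r //; lra.
have L_le : L <= l by lra.
have Cl : C * l <= l / 512.
  have : rho * l <= 1 / 2 * l by rewrite ler_pM2r // ltW.
  by lra.
have L_ge : l / 2 <= L by lra.
have C'k0 : 0 < C' * k%:R by rewrite mulr_gt0 //; lra.
move: nk; rewrite /rounds_to -/L ltr_norml => /andP[nlo nhi].
(* As [n >= 2], a rounding error below 1 costs at most a factor 2. *)
have nle : n%:R <= 2 * C' * k%:R * L by lra.
split; split=> //.
- by rewrite -(ltr0n R); lra.
- have : l <= C * (2 * C' * k%:R * l).
    apply: le_trans lCN _; rewrite ler_pM2l // (le_trans nle) //.
    by rewrite ler_pM2l //; lra.
  have -> : C * (2 * C' * k%:R * l) = 2 * C * C' * k%:R * l by ring.
  by rewrite -[X in X <= _]mul1r ler_pM2r.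
- have : rho ^+ 2 * (l / 2) <= rho ^+ 2 * L by rewrite ler_pM2l ?exprn_gt0.
  by lra.
- by lra.
- have : rho * (l - C * l - 1) <= rho * L by rewrite ler_pM2l //; lra.
  have : rho * (C * l) <= 1 / 2 * (C * l) by rewrite ler_pM2r ?mulr_gt0 // ltW.
  by lra.
Qed.

Lemma ln_inv_le (R : realType) (rho : R) : 0 < rho -> rho * ln (1 / rho) <= 1.
Proof.
move=> r0; have l_le : ln (1 / rho) <= 1 / rho by rewrite ltW // ln_sublinear // divr_gt0.
by have := ler_wpM2l (ltW r0) l_le; rewrite div1r divff ?lt0r_neq0.
Qed.

(** After squaring, the claim is [n ln (1/rho) <= rho^2/64 k L]; the spare factor [rho] in the bound
    on [n] absorbs the logarithm, by [ln_inv_le]. *)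
Lemma threshold_le_sqrt (R : realType) (rho L : R) n k :
  0 < rho < 1 -> (0 < n)%N -> (0 < k)%N -> 0 < L ->
  n%:R <= rho ^+ 3 / 64 * (k%:R * L) ->
  threshold rho k <= Num.sqrt (2 * (L / n%:R)) * k%:R * (rho / 8).
Proof.
move=> /andP[r0 r1] n0 k0 L0 nL.
have n0' : 0 < n%:R :> R by rewrite ltr0n.
have k0' : 0 < k%:R :> R by rewrite ltr0n.
have l0 : 0 <= ln (1 / rho) by rewrite ln_ge0 // ler_pdivlMr //; lra.
rewrite -ler_sqr ?nnegrE ?sqrtr_ge0 ?mulr_ge0 ?invr_ge0 ?(ltW r0) ?sqrtr_ge0 //.
rewrite sqr_sqrtr ?mulr_ge0 // !exprMn sqr_sqrtr ?mulr_ge0 ?invr_ge0 ?(ltW L0) //.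
have -> : 2 * (L / n%:R) * k%:R ^+ 2 * (rho ^+ 2 * 8^-1 ^+ 2)
    = 2 * k%:R * (rho ^+ 2 / 64 * (k%:R * L) / n%:R) by field; rewrite lt0r_neq0.
rewrite ler_pM2l ?mulr_gt0 // ler_pdivlMr //.
apply: le_trans (ler_wpM2l l0 nL) _.
have -> : ln (1 / rho) * (rho ^+ 3 / 64 * (k%:R * L))
   = rho ^+ 2 / 64 * (k%:R * L) * (rho * ln (1 / rho)) by ring.
by rewrite ler_piMr ?ln_inv_le // mulr_ge0 ?divr_ge0 ?sqr_ge0 ?mulr_ge0 ?ler0n ?(ltW L0).
Qed.

(** In the exponent, [d^k] costs at most [k L (1 + rho/16)] and [2^n] at most [k L rho/256]. What is
    left of [k L rho/4] exceeds [k/6], since [rho L >= 2]. *)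
Lemma block_union_small (R : realType) (rho L : R) n d k :
  0 < rho < 1 / 2 -> (0 < d)%N -> (0 < k)%N -> 128 * 128 <= rho ^+ 2 * L ->
  n%:R <= rho ^+ 3 / 64 * (k%:R * L) -> ln d%:R <= L * (1 + rho / 16) ->
  2 ^+ n * d%:R ^+ k * expR (- (k%:R * L * (1 + rho / 4))) <= expR (- (k%:R / 6)).
Proof.
move=> /andP[r0 r2] d0 k0 Lbig nL dL.
have k0' : 0 < k%:R :> R by rewrite ltr0n.
have rho2_gt0 : 0 < rho ^+ 2 by rewrite exprn_gt0.
have L0 : 0 < L by rewrite -(pmulr_rgt0 _ rho2_gt0); lra.
apply: (@le_trans _ _ (expR 1 ^+ n * expR (ln d%:R) ^+ k *
    expR (- (k%:R * L * (1 + rho / 4))))).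
  rewrite ler_pM2r ?expR_gt0 // lnK ?posrE ?ltr0n // ler_pM2r ?exprn_gt0 ?ltr0n //.
  by rewrite lerXn2r ?nnegrE ?expR_ge0 //; apply: le_trans (expR_ge1Dx 1); lra.
rewrite -!expRM_natl mulr1 -!expRD ler_expR.
have KL0 : 0 < k%:R * L by rewrite mulr_gt0.
have rho2 : rho ^+ 2 <= rho / 2 by rewrite expr2; nra.
have rho3 : rho ^+ 3 <= rho ^+ 2 / 2 by rewrite exprS; nra.
have {}nL : n%:R <= rho / 256 * (k%:R * L).
  by apply: le_trans nL _; rewrite ler_pM2r //; lra.
have kd := ler_wpM2l (ltW k0') dL.
have rL : 2 <= rho * L.
  have : rho ^+ 2 * L <= rho / 2 * L by rewrite ler_pM2r.
  by lra.
have := ler_wpM2l (ltW k0') rL.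
by lra.
Qed.

(** * Soundness and completeness *)

(** Reduces a probability to counting: given [X], the output [t] is independent of [y], so the sum
    over [t] can be taken outside the count of [y]. Here [c X] bounds the conditional probability of
    [E] given [X]. *)
Lemma Pr_run_le (R : realType) n d (M : 'M[bool]_(n, d) -> 'rV[bool]_d -> R)
    (E : pred ('M[bool]_(n, d) * 'rV[bool]_d * 'rV[bool]_d)) (c : 'M[bool]_(n, d) -> R) :
  (forall X, \sum_t M X t * #|[set y | E (X, y, t)]|%:R <= 2 ^+ d * c X) ->
  Pr (run (uniform R ('M[bool]_(n, d) * 'rV[bool]_d)%type) (fun Xy => M Xy.1)) E
    <= (\sum_X c X) / 2 ^+ (n * d).
Proof.
move=> Hc; set p := run _ _.
have -> : Pr p E = \sum_X \sum_y \sum_t if E (X, y, t) then p (X, y, t) else 0.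
  by rewrite pair_bigA pair_bigA /Pr big_mkcond; apply: eq_bigr => -[[X y] t].
rewrite mulr_suml; apply: ler_sum => X _.
rewrite ler_pdivlMr ?exprn_gt0 // -(ler_pM2l (_ : 0 < 2 ^+ d)) ?exprn_gt0 //.
apply: le_trans (Hc X); rewrite exchange_big /= mulr_suml mulr_sumr.
apply: ler_sum => t _; rewrite -sum1_card natr_sum mulr_suml !mulr_sumr [leRHS]big_mkcond /=.
apply: ler_sum => y _; rewrite inE; case: ifP => _; last by rewrite mul0r mulr0.
rewrite /p /run /uniform /= card_prod !card_mx card_bool mul1n natrM !natrX.
rewrite le_eqVlt; apply/orP; left; apply/eqP.
have : 2 ^+ (n * d) != 0 :> R by rewrite lt0r_neq0 ?exprn_gt0.
have : 2 ^+ d != 0 :> R by rewrite lt0r_neq0 ?exprn_gt0.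
by move: (2 ^+ (n * d)) (2 ^+ d) (M X t) => a b m b0 a0; field; rewrite a0 b0.
Qed.

Lemma Pr_run_le_const (R : realType) n d (M : 'M[bool]_(n, d) -> 'rV[bool]_d -> R)
    (E : pred ('M[bool]_(n, d) * 'rV[bool]_d * 'rV[bool]_d)) (c : R) :
  (forall X, \sum_t M X t * #|[set y | E (X, y, t)]|%:R <= 2 ^+ d * c) ->
  Pr (run (uniform R ('M[bool]_(n, d) * 'rV[bool]_d)%type) (fun Xy => M Xy.1)) E <= c.
Proof.
move=> Hc; apply: le_trans (Pr_run_le (c := fun=> c) Hc) _.
rewrite sumr_const card_mx card_bool -[c *+ _]mulr_natr natrX mulfK //.
by rewrite expf_neq0 // pnatr_eq0.
Qed.

(** Suppose the set [G] of accepted rows has size at most [(1 - rho) n]. In units of [n k z], the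
    rows in [G] contribute less than [1 - 3 rho/8] and the rejected ones at most [rho/8], while
    accuracy forces a total of at least [1 - rho/8]. *)
Lemma many_accepting_rows (R : realType) (rho C alpha z tau v : R) n d k
    (X : 'M[bool]_(n, d)) t :
  0 < rho < 1 -> (0 < n)%N -> (0 < k)%N -> 0 < z ->
  C <= rho / 16 -> alpha <= C * z -> (1 - rho / 16) * z <= v ->
  tau <= z * k%:R * (rho / 8) ->
  approx_topk k alpha X t -> v <= kth_marginal R X k ->
  ~~ [exists G : {set 'I_n}, exists t : 'rV[bool]_d,
        [&& #|G|%:R <= (1 - rho) * n%:R, #|[set j | t 0 j]| == k &
            z * k%:R * n%:R * (1 - 3 * rho / 8) <= \sum_(i in G) inner R (row i X) t]] ->
  (1 - rho) * n%:R < #|[set i | tau <= inner R (row i X) t]|%:R.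
Proof.
move=> /andP[r0 r1] n0 k0 z0 Cr az vz tau_le topt vk noG.
have n0' : 0 < n%:R :> R by rewrite ltr0n.
have k0' : 0 < k%:R :> R by rewrite ltr0n.
rewrite ltNge; apply/negP => Gle; set G := [set i | _] in Gle.
move: noG; rewrite negb_exists => /forallP /(_ G); rewrite negb_exists => /forallP /(_ t).
rewrite Gle /=; have /andP[-> _] /= := topt.
rewrite -ltNge => Gsum.
set b := z * k%:R * (rho / 8) in tau_le.
have b0 : 0 <= b by rewrite mulr_ge0 ?mulr_ge0 ?(ltW z0) //; lra.
have Csum : \sum_(i | i \notin G) inner R (row i X) t <= n%:R * b.
  have -> : n%:R * b = \sum_(i < n) b by rewrite sumr_const card_ord mulr_natl.
  rewrite big_mkcond; apply: ler_sum => i _; case: ifP => //.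
  by rewrite inE -ltNge => /ltW /le_trans; apply.
have := sum_inner_topk_ge topt vk; rewrite (bigID (mem G)) /= => total.
have lo : n%:R * (k%:R * (z * (1 - rho / 8))) <= n%:R * (k%:R * (v - alpha)).
  rewrite !ler_pM2l //.
  have : C * z <= rho / 16 * z by rewrite ler_pM2r.
  by lra.
have : 0 < n%:R * (k%:R * (z * rho)) by rewrite !mulr_gt0.
by move: total lo Gsum Csum; rewrite /b; lra.
Qed.

Lemma attackerE (R : realType) (rho : R) d k (y t : 'rV[bool]_d) :
  (attacker rho k y t == IN) = (threshold rho k <= inner R y t).
Proof. by rewrite /attacker; case: ifP. Qed.

Lemma topk_failure (R : realType) (rho alpha : R) n d k
    (M : 'M[bool]_(n, d) -> 'rV[bool]_d -> R) X :
  randomized M -> 1 - rho <= Pr (M X) (fun t => approx_topk k alpha X t) ->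
  \sum_(t | ~~ approx_topk k alpha X t) M X t <= rho.
Proof.
move=> /(_ X)[_ M1]; rewrite /Pr.
by move: M1; rewrite (bigID (fun t => approx_topk k alpha X t)) /=; lra.
Qed.

Lemma soundness_le_half (R : realType) (tau : R) n d
    (M : 'M[bool]_(n, d) -> 'rV[bool]_d -> R) X :
  randomized M -> 0 < tau ->
  \sum_t M X t * #|[set y | tau <= inner R y t]|%:R <= 2 ^+ d * (1 / 2).
Proof.
move=> /(_ X)[M0 M1] tau0.
apply: (@le_trans _ _ (\sum_t M X t * (2 ^+ d * (1 / 2)))); last first.
  by rewrite -mulr_suml M1 mul1r.
by apply: ler_sum => t _; rewrite ler_wpM2l // inner_tail_half.
Qed.

Lemma soundness_le (R : realType) (rho alpha : R) n d k
    (M : 'M[bool]_(n, d) -> 'rV[bool]_d -> R) X :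
  0 < rho < 1 / 2 -> (0 < k)%N -> 2 * ln (1 / rho) <= rho ^+ 2 * k%:R ->
  randomized M -> 1 - rho <= Pr (M X) (fun t => approx_topk k alpha X t) ->
  \sum_t M X t * #|[set y | threshold rho k <= inner R y t]|%:R <= 2 ^+ d * rho.
Proof.
move=> /andP[r0 r2] k0 hk Mr good.
have r01 : 0 < rho < 1 by rewrite r0; lra.
have [M0 M1] := Mr X; move: good; rewrite /Pr.
pose P t := approx_topk k alpha X t.
rewrite -/P (eq_bigl P) //; set g := \sum_(t | P t) _ => g1.
have bad : \sum_(t | ~~ P t) M X t = 1 - g.
  by move: M1; rewrite (bigID P) /= -/g; lra.
pose a := rho / (1 - rho) / 2.
have a_rho : (1 - rho) * a = rho / 2 by rewrite /a; field; rewrite lt0r_neq0 //; lra.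
(* The acceptance bound is [a] on accurate outputs and 1/2 on the others. As [a <= 1/2], the mixture
   is worst at [g = 1 - rho], where it equals [rho/2 + rho/2]. *)
have a2 : a <= 1 / 2 by rewrite /a ler_pM2r ?invr_gt0 // ler_pdivrMr; lra.
rewrite (bigID P) /=.
apply: (@le_trans _ _ (g * (2 ^+ d * a) + (1 - g) * (2 ^+ d * (1 / 2)))).
  apply: lerD; first last.
    rewrite -bad mulr_suml; apply: ler_sum => t _; rewrite ler_wpM2l // inner_tail_half //.
    exact: threshold_gt0.
  rewrite mulr_suml; apply: ler_sum => t /andP[/eqP tk _]; rewrite ler_wpM2l //.
  by apply: inner_tail_threshold => //; rewrite ltr0n.
rewrite mulrCA [(1 - g) * _]mulrCA -mulrDr ler_pM2l ?exprn_gt0 //.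
by have : (1 - rho) * (1 / 2 - a) <= g * (1 / 2 - a); [rewrite ler_wpM2r; lra | lra].
Qed.

(** Given [X], the event has probability at most 1 on [E2] and [E3]. Elsewhere it can only occur on
    an inaccurate output, hence with probability at most [rho]. *)
Lemma completeness_le (R : realType) (rho alpha : R) n d k
    (M : 'M[bool]_(n, d) -> 'rV[bool]_d -> R) (B : 'M[bool]_(n, d) -> pred 'rV[bool]_d)
    (E2 E3 : {set 'M[bool]_(n, d)}) (p : R) :
  randomized M ->
  (forall X, 1 - rho <= Pr (M X) (fun t => approx_topk k alpha X t)) ->
  (forall X t, approx_topk k alpha X t -> B X t -> X \in E2 :|: E3) ->
  #|E2|%:R <= 2 ^+ (n * d) * p -> #|E3|%:R <= 2 ^+ (n * d) * p ->
  Pr (run (uniform R ('M[bool]_(n, d) * 'rV[bool]_d)%type) (fun Xy => M Xy.1))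
     (fun '(X, y, t) => B X t) <= rho + 2 * p.
Proof.
move=> Mr good cov h2 h3.
pose c X : R := rho + (X \in E2)%:R + (X \in E3)%:R.
apply: (@le_trans _ _ ((\sum_X c X) / 2 ^+ (n * d))).
  apply: Pr_run_le => X; have [M0 M1] := Mr X.
  have -> : \sum_t M X t * #|[set y : 'rV[bool]_d | B X t]|%:R
          = 2 ^+ d * \sum_(t | B X t) M X t.
    rewrite mulr_sumr [RHS]big_mkcond; apply: eq_bigr => t _.
    case: (B X t); last first.
      have -> : [set y : 'rV[bool]_d | false] = set0 by apply/setP => y; rewrite !inE.
      by rewrite cards0 mulr0.
    rewrite (_ : [set y | true] = setT); last by apply/setP=> y; rewrite !inE.
    by rewrite cardsT card_mx card_bool mul1n natrX mulrC.
  rewrite ler_pM2l ?exprn_gt0 //.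
  have [XE|XE] := boolP (X \in E2 :|: E3).
    have r0 : 0 <= rho.
      apply: le_trans (topk_failure Mr (good X)); exact: sumr_ge0.
    apply: (@le_trans _ _ 1).
      by rewrite -M1 big_mkcond; apply: ler_sum => t _; case: ifP.
    by move: XE; rewrite /c inE => /orP[] ->; rewrite ?lerDr ?addr_ge0 // addrAC lerDr addr_ge0.
  apply: (@le_trans _ _ rho); last by rewrite /c -addrA lerDl addr_ge0.
  apply: le_trans (topk_failure Mr (good X)).
  rewrite big_mkcond [leRHS]big_mkcond; apply: ler_sum => t _.
  case: ifP => Bt; last by case: ifP.
  by case: ifP => // /negbFE topt; case/negP: XE; exact: cov topt Bt.
rewrite ler_pdivrMr ?exprn_gt0 // !big_split /= -!natr_sum.
have sumE (E : {set 'M[bool]_(n, d)}) : (\sum_X (X \in E) = #|E|)%N.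
  by rewrite -sum1_card [RHS]big_mkcond; apply: eq_bigr => X _; case: (X \in E).
rewrite !sumE sumr_const card_mx card_bool -[rho *+ _]mulr_natr natrX.
by lra.
Qed.

Theorem theorem4p1 (R : realType) (rho : R) (rho_gt0 : 0 < rho) :
  exists C C' : R,
    [/\ 0 < C < 1, 0 < C' < 1 &
     exists d0 : nat, forall (n d k : nat) (alpha : R),
       (d0 <= d)%N ->
       0 < alpha < 1 ->
       d%:R <= 2 `^ (C * n%:R) ->
       k%:R <= d%:R `^ C ->
       rounds_to (C' * k%:R * ln (d%:R / (2 * k%:R))) n ->
       alpha <= C * Num.sqrt (ln (d%:R / (2 * k%:R)) / n%:R) ->
       forall that : 'M[bool]_(n, d) -> 'rV[bool]_d -> R,
         randomized that ->
         (forall X, Pr (that X) (fun t => approx_topk k alpha X t) >= 1 - rho) ->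
         (* law of ((X, y), t), where (X, y) is uniform and t is drawn from
            that X *)
         let law := run (uniform R ('M[bool]_(n, d) * 'rV[bool]_d)%type)
                        (fun Xy => that Xy.1) in
         Pr law (fun '(X, y, t) => attacker rho k y t == IN) <= rho
         /\
         Pr law (fun '(X, y, t) =>
             #|[set i : 'I_n | attacker rho k (row i X) t == IN]|%:R
               < (1 - expR 1 ^+ 2 * rho) * n%:R)
           < 2 * rho + 2 * expR (- (k%:R / 6))].
Proof.
have attacker_set k d (t : 'rV[bool]_d) :
    [set y | attacker rho k y t == IN] = [set y | threshold rho k <= inner R y t].
  by apply/setP => y; rewrite !inE attackerE.
have e2 : 4 <= expR 1 ^+ 2 :> R.
  have : 2 <= expR 1 :> R by apply: le_trans (expR_ge1Dx 1); lra.
  by rewrite expr2; nra.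
(* For rho >= 1/2 the second event is empty, as e^2 rho > 1. *)
have [rho_half|rho_half] := leP (1 / 2) rho.
  exists (1 / 2), (1 / 2); split; [lra|lra|exists 2%N].
  move=> n d k alpha d2 _ dn _ nk _ M Mr good law; split; last first.
    rewrite /Pr big_pred0 => [|[[X y] t]]; last first.
      apply/negbTE; rewrite -leNgt; apply: le_trans (ler0n _ _).
      by rewrite nmulr_rle0 ?ler0n //; nra.
    by have := expR_gt0 (- (k%:R / 6) : R); lra.
  (* [2 <= d <= 2^(n/2)] excludes [n = 0], whereas [k = 0] would round to [n = 0]. *)
  have k0 : (0 < k)%N.
    rewrite lt0n; apply: contraTneq nk => k0; rewrite /rounds_to k0 mulr0 mul0r subr0.
    rewrite ger0_norm // -leNgt ler1n lt0n; apply: contraTneq dn => ->.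
    by rewrite mulr0 powRr0 -ltNge ltr1n.
  have [rho1|rho1] := leP 1 rho.
    apply: Pr_run_le_const => X; have [M0 M1] := Mr X.
    apply: (@le_trans _ _ (\sum_t M X t * 2 ^+ d)); last first.
      by rewrite -mulr_suml M1 mul1r ler_peMr ?exprn_ge0.
    apply: ler_sum => t _; rewrite ler_wpM2l //.
    have -> : 2 ^+ d = #|{: 'rV[bool]_d}|%:R :> R by rewrite card_mx card_bool mul1n natrX.
    by rewrite ler_nat max_card.
  apply: Pr_run_le_const => X.
  under eq_bigr do rewrite /= attacker_set.
  have tau0 : 0 < threshold rho k by rewrite threshold_gt0 ?rho_gt0.
  apply: le_trans (soundness_le_half X Mr tau0) _.
  by rewrite ler_pM2l ?exprn_gt0.
(* [C'] is such that [n <= 2 C' k L] is the bound on [n] in [threshold_le_sqrt]; [C] is such that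
   [8 C = eps^2] for the [eps] below, which yields [Lneps]. *)
pose C := rho ^+ 2 / (64 * 128); pose C' := rho ^+ 3 / 128.
have rho2 : rho ^+ 2 <= rho / 2 by rewrite expr2; nra.
have rho3 : rho ^+ 3 <= rho ^+ 2 / 2 by rewrite exprS; nra.
have rho2_gt0 : 0 < rho ^+ 2 by rewrite exprn_gt0.
have rho3_gt0 : 0 < rho ^+ 3 by rewrite exprn_gt0.
have C0 : 0 < C by rewrite /C; lra.
have Cr : C <= rho / 16 by rewrite /C; lra.
(* The loss [(1 - eps)/(1 + eps) >= 1 - 2 eps] in the marginals is then at most [rho/16]. *)
pose eps := rho / 32.
have eps2 : eps ^+ 2 = rho ^+ 2 / (32 * 32) by rewrite /eps; field.
have eps01 : 0 < eps <= 1 by rewrite /eps; lra.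
have v_ge : 1 - rho / 16 <= (1 - eps) / (1 + eps).
  rewrite ler_pdivlMr; last by lra.
  have : 0 <= eps * eps by rewrite mulr_ge0 //; lra.
  by rewrite /eps; lra.
have r2 : 0 < rho < 1 / 2 by rewrite rho_gt0.
have r01 : 0 < rho < 1 by rewrite rho_gt0; lra.
have rl := ln_inv_le rho_gt0.
exists C, C'; split; [rewrite /C; lra|rewrite /C'; lra|].
exists (Num.truncn (expR (256 * 128 / rho ^+ 2))).+1.
move=> n d k alpha d0d _ dn kd nk aC M Mr good law.
have dbig : expR (256 * 128 / rho ^+ 2) <= d%:R.
  by apply: (le_trans (ltW (truncnS_gt _))); rewrite ler_nat.
have [] := parameter_regime r2 (erefl C) (erefl C') dbig dn kd nk.
set L := ln _ in aC *; rewrite -/C -/C' => -[n0 k0 CCk Lbig] [nL Ln dL].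
have n0' : 0 < n%:R :> R by rewrite ltr0n.
have k0' : 0 < k%:R :> R by rewrite ltr0n.
have d0 : (0 < d)%N by rewrite -(ltr0n R); apply: lt_le_trans dbig; exact: expR_gt0.
have L0 : 0 < L by rewrite -(pmulr_rgt0 _ rho2_gt0) (lt_le_trans _ Lbig) ?mulr_gt0.
clear d0d dn kd nk dbig.
have Kbig : 64 * 128 * 64 <= rho ^+ 5 * k%:R.
  by move: CCk; rewrite /C /C'; lra.
have nL' : n%:R <= rho ^+ 3 / 64 * (k%:R * L) by move: nL; rewrite /C'; lra.
split.
  apply: Pr_run_le_const => X.
  under eq_bigr do rewrite /= attacker_set.
  apply: (@soundness_le _ _ alpha) => //.
  (* The required lower bound on [k] is multiplied by [rho^3]: its left side becomes at most
     [2 rho^2], and [Kbig] bounds the right side [rho^5 k] from below. *)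
  have : 2 * (rho ^+ 3 * ln (1 / rho)) <= 2 * rho ^+ 2.
    by rewrite ler_pM2l // exprSr -mulrA ler_piMr // ltW.
  move=> h; rewrite -(ler_pM2l rho3_gt0).
  have : rho ^+ 3 * (rho ^+ 2 * k%:R) = rho ^+ 5 * k%:R by ring.
  by lra.
pose z := Num.sqrt (2 * (L / n%:R)).
have z2 : z ^+ 2 = 2 * (L / n%:R) by rewrite sqr_sqrtr // mulr_ge0 ?divr_ge0 ?ltW.
have z0 : 0 < z by rewrite sqrtr_gt0 mulr_gt0 // divr_gt0.
have Lneps : 2 * (L / n%:R) <= eps ^+ 2.
  rewrite mulrA ler_pdivrMr // eps2.
  have h : L <= 2 * C * C' * k%:R * L by rewrite ler_peMl // ltW.
  have : 2 * C * (C' * k%:R * L) <= 2 * C * (2 * n%:R).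
    by rewrite ler_pM2l // mulr_gt0.
  move=> h'; have : L <= 4 * (C * n%:R) by lra.
  by rewrite /C; lra.
have epsL : 16 <= eps ^+ 2 * L by rewrite eps2; lra.
have h2 := many_large_marginals n0 k0 d0 eps01 Lneps epsL (erefl L).
rewrite -/z in h2; set v := (1 - eps) / (1 + eps) * z in h2.
have rho1 : 0 <= (1 - rho) * n%:R by rewrite mulr_ge0 // subr_ge0 ltW //; case/andP: r01.
have h3 := large_block_sums n d k (z * k%:R * n%:R * (1 - 3 * rho / 8)) (ltW z0) rho1.
(* With tilt [z] and [n z^2 = 2 L], the exponent is [k L ((1 - rho) - 2 (1 - 3 rho/8))]. The excess
   [rho/4] over [k L] is what beats the union bound. *)
have E : z ^+ 2 / 2 * ((1 - rho) * n%:R * k%:R) - z * (z * k%:R * n%:R * (1 - 3 * rho / 8))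
    = - (k%:R * L * (1 + rho / 4)).
  rewrite (_ : z * _ = z ^+ 2 * (k%:R * n%:R * (1 - 3 * rho / 8))); last by ring.
  by rewrite z2; field; rewrite lt0r_neq0.
rewrite E in h3.
have small := block_union_small r2 d0 k0 Lbig nL' dL.
have {}h3 := le_trans h3 (ler_wpM2l (exprn_ge0 _ (ler0n _ _)) small).
apply: (@le_lt_trans _ _ (rho + 2 * expR (- (k%:R / 6)))); last by rewrite ltrD2r mulr_natl mulr2n ltrDl.
apply: (completeness_le Mr good _ h2 h3) => X t topt few.
apply: contraTT few; rewrite !inE negb_or => /andP[no2 no3].
rewrite -leNgt.
have vk : v <= kth_marginal R X k.
  by apply: kth_marginal_ge => //; rewrite leqNgt.
have tau_le := threshold_le_sqrt r01 n0 k0 L0 nL'.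
have vz : (1 - rho / 16) * z <= v.
  by rewrite ler_pM2r.
have aCz : alpha <= C * z.
  apply: le_trans aC _; rewrite ler_pM2l // ler_wsqrtr // ler_peMl ?ler1n //.
  by rewrite divr_ge0 // ltW.
have := many_accepting_rows r01 n0 k0 z0 Cr aCz vz tau_le topt vk no3.
have -> : [set i | attacker rho k (row i X) t == IN]
        = [set i | threshold rho k <= inner R (row i X) t].
  by apply/setP => i; rewrite !inE attackerE.
(* More than [(1 - rho) n] rows are accepted, and [e^2 >= 1]. *)
move=> /ltW; apply: le_trans; rewrite ler_pM2r // lerB // ler_peMl ?(ltW rho_gt0) //.
by apply: le_trans e2; rewrite ler1n.
Qed.
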